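(* For every real $x>0$, $$\frac{1}{2}\psi'\left(x+\frac{1}{3}\right)<\log x-\psi(x)<\frac{1}{2}\psi'\left(x+\frac{1}{3}-\frac{1}{12x+3}\right).$$
   Context: $\Gamma$ is the classical Euler gamma function, $\psi(x)=\Gamma'(x)/\Gamma(x)$ for $x>0$ is the digamma function, $\psi'$ is its derivative (the trigamma function), and $\log$ is the natural logarithm. *)

(* Defs.v *)
From mathcomp Require Import all_boot all_order all_algebra.
From mathcomp Require Import all_classical all_reals all_analysis.
Import Order.TTheory GRing.Theory Num.Theory.
Import numFieldNormedType.Exports.

Set Implicit Arguments.
Unset Strict Implicit.
Unset Printing Implicit Defensive.

Local Open Scope classical_set_scope.
Local Open Scope ring_scope.

(* Euler's integral of the second kind, meaningful for x > 0 only: for x <= 0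
   the integral diverges and Rintegral returns 0. *)
Definition Gamma (R : realType) (x : R) : R :=
  \int[@lebesgue_measure R]_(t in `]0, +oo[) (t `^ (x - 1) * expR (- t)).

Definition digamma (R : realType) (x : R) : R := derive1 (@Gamma R) x / Gamma x.

Definition trigamma (R : realType) : R -> R := derive1 (@digamma R).

(* Main.v *)
(* The function [ln Gamma] is convex and satisfies L(x + 1) = L(x) + ln x.
   Convexity traps the slopes of L near x + n between ln(x + n - 1) and
   ln(x + n), so L has no corner at x + n, hence none at x: L is differentiable
   and ln x - 1/x <= digamma x <= ln x. Since digamma(x + 1) = digamma x + 1/x
   and digamma - ln vanishes at infinity, telescoping the concavity defect of
   digamma shows that it is concave, and the same slope argument makes it
   differentiable, with 1/x <= trigamma x <= 1/x + 1/x^2.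
   All remaining inequalities are obtained by telescoping too: a function F
   that tends to 0 at infinity and satisfies F(x + 1) < F(x) is positive. For
   the lower bound, F(x) - F(x + 1) is elementary. For the upper bound, with
   h(x) = x + 1/3 - 1/(12 x + 3), one has h(x + 1) > h(x) + 1, and
   trigamma u - trigamma v > 1/u - 1/v for u < v reduces F(x) - F(x + 1) to an
   elementary function with negative derivative. *)
Require Import Defs.
From mathcomp Require Import all_boot all_order all_algebra.
From mathcomp Require Import all_classical all_reals all_analysis.
From mathcomp Require Import measurable_realfun ring lra.
Import Order.TTheory GRing.Theory Num.Theory.
Import numFieldNormedType.Exports.
Set Implicit Arguments.
Unset Strict Implicit.
Unset Printing Implicit Defensive.
Local Open Scope classical_set_scope.
Local Open Scope ring_scope.

(** * Improper integrals over the open half-line by antiderivatives *)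

Section FTC_0y.
Context {R : realType}.
Notation mu := (@lebesgue_measure R).

Lemma measurable_fun_continuous_0y (f : R -> R) :
  (forall t : R, 0 < t -> {for t, continuous f}) ->
  measurable_fun (`]0, +oo[ : set R) f.
Proof.
move=> cf; apply: open_continuous_measurable_fun => //.
by move=> t; rewrite inE/= in_itv/= andbT => /cf.
Qed.

(** The half-line is exhausted by the intervals [[1 / (n + 1), +oo[], whose closed left end lies
    inside the domain of differentiability; monotone convergence gives the limit of the integrals,
    and [F (1 / (n + 1))] tends to [l0]. *)
Lemma ge0_continuous_FTC2_0y (f F : R -> R) (l0 l : R) :
  (forall t : R, 0 < t -> 0 <= f t) ->
  (forall t : R, 0 < t -> {for t, continuous f}) ->
  (forall t : R, 0 < t -> is_derive t 1 F (f t)) ->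
  F t @[t --> 0^'+] --> l0 -> F t @[t --> +oo] --> l ->
  (\int[mu]_(t in `]0%R, +oo[) (f t)%:E = (l - l0)%:E)%E.
Proof.
move=> f0 cf dF Fl0 Fl.
have mf := measurable_fun_continuous_0y cf.
pose A (n : nat) : set R := `[n.+1%:R^-1, +oo[%classic.
have An0 (n : nat) : 0 < n.+1%:R^-1 :> R by rewrite invr_gt0.
have AS n : A n `<=` (`]0, +oo[ : set R).
  by move=> t; rewrite /A/= !in_itv/= !andbT; exact: lt_le_trans.
have -> : (`]0, +oo[%classic : set R) = \bigcup_n A n.
  apply/seteqP; split=> [t /=|t [n _ /AS]//].
  rewrite in_itv/= andbT => t0.
  exists (Num.bound t^-1) => //; rewrite /A/= in_itv/= andbT.
  rewrite invf_ple ?posrE// (le_trans (ltW (archi_boundP _)))//.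
    by rewrite invr_ge0 ltW.
  by rewrite ler_nat.
have intA n : (\int[mu]_(t in A n) (f t)%:E = (l - F n.+1%:R^-1)%:E)%E.
  rewrite (@ge0_continuous_FTC2y _ f F n.+1%:R^-1 l)//.
  - by move=> t nt; apply: f0; exact: lt_le_trans nt.
  - apply: continuous_in_subspaceT => t.
    by rewrite inE => /AS/=; rewrite in_itv/= andbT => /cf.
  - by move=> t nt; apply: ex_derive; apply: dF; exact: lt_trans nt.
  - apply: cvg_at_right_filter; apply: differentiable_continuous.
    by apply/derivable1_diffP; apply: ex_derive; exact: dF.
  - move=> t; rewrite in_itv/= andbT => nt.
    have t0 : 0 < t by exact: lt_trans nt.
    by rewrite derive1E; have /@derive_val := dF _ t0.
have : (\int[mu]_(t in A n) (f t)%:E @[n --> \oo] -->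
        \int[mu]_(t in \bigcup_n A n) (f t)%:E)%E.
  apply: ge0_nondecreasing_set_cvg_integral.
  - move=> m n mn; rewrite subsetEset => t; rewrite /A/= !in_itv/= !andbT.
    by apply: le_trans; rewrite lef_pV2 ?posrE// ler_nat.
  - by move=> n; exact: measurable_itv.
  - move=> n; apply/measurable_EFinP.
    exact: (measurable_funS _ (@AS n) mf).
  - move=> n t /AS/=; rewrite in_itv/= andbT => t0.
    by rewrite lee_fin f0.
under eq_cvg do rewrite intA.
move=> /cvg_lim <-//; apply: cvg_lim => //.
apply: cvg_EFin; first by near=> n.
apply: cvgB; first exact: cvg_cst.
apply: (@cvg_comp _ _ _ (fun n : nat => n.+1%:R^-1 : R) F _ (0^'+) _) Fl0.
move=> P [e /= e0 eP].
have : \forall n \near \oo, n.+1%:R^-1 < e.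
  have /cvgrPdist_lt/(_ _ e0) := @cvg_harmonic R.
  by apply: filterS => n /=; rewrite sub0r normrN ger0_norm.
apply: filterS => n /= ne; apply: eP => //=.
by rewrite sub0r normrN ger0_norm// ltW.
Unshelve. all: by end_near. Qed.

End FTC_0y.

(** * Integrability, and integrands of varying sign *)

Section FTC_dominated.
Context {R : realType}.
Notation mu := (@lebesgue_measure R).

Lemma ge0_continuous_FTC2_0y_integrable (g G : R -> R) (l0 l : R) :
  (forall t : R, 0 < t -> 0 <= g t) ->
  (forall t : R, 0 < t -> {for t, continuous g}) ->
  (forall t : R, 0 < t -> is_derive t 1 G (g t)) ->
  G t @[t --> 0^'+] --> l0 -> G t @[t --> +oo] --> l ->
  mu.-integrable `]0, +oo[ (EFin \o g) /\
  \int[mu]_(t in `]0, +oo[) g t = l - l0.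
Proof.
move=> g0 cg dG G0 Gl.
have ig := ge0_continuous_FTC2_0y g0 cg dG G0 Gl.
split; last by rewrite /Rintegral ig.
apply/integrableP; split.
  by apply/measurable_EFinP; exact: measurable_fun_continuous_0y.
have -> : (\int[mu]_(t in `]0%R, +oo[) `|(EFin \o g) t| =
    \int[mu]_(t in `]0%R, +oo[) (g t)%:E)%E; last by rewrite ig ltry.
apply: eq_integral => t; rewrite inE/= in_itv/= andbT => t0.
by rewrite ger0_norm// g0.
Qed.

(* [F + G] and [G] are both nondecreasing. *)
Lemma dominated_FTC2_0y (f F g G : R -> R) (l0 l m0 m : R) :
  (forall t : R, 0 < t -> `|f t| <= g t) ->
  (forall t : R, 0 < t -> {for t, continuous f}) ->
  (forall t : R, 0 < t -> {for t, continuous g}) ->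
  (forall t : R, 0 < t -> is_derive t 1 F (f t)) ->
  (forall t : R, 0 < t -> is_derive t 1 G (g t)) ->
  F t @[t --> 0^'+] --> l0 -> F t @[t --> +oo] --> l ->
  G t @[t --> 0^'+] --> m0 -> G t @[t --> +oo] --> m ->
  \int[mu]_(t in `]0, +oo[) f t = l - l0.
Proof.
move=> fg cf cg dF dG F0 Fl G0 Gm.
have g0 t : 0 < t -> 0 <= g t by move=> /fg; exact: le_trans.
have [ig intg] := ge0_continuous_FTC2_0y_integrable g0 cg dG G0 Gm.
have [ifg intfg] : mu.-integrable `]0, +oo[ (EFin \o (f + g)) /\
  \int[mu]_(t in `]0, +oo[) (f + g) t = (l + m) - (l0 + m0).
  apply: (@ge0_continuous_FTC2_0y_integrable _ (F + G)).
  - by move=> t /fg; rewrite ler_norml => /andP[+ _]; rewrite -subr_ge0 opprK.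
  - by move=> t t0; apply: continuousD; [exact: cf|exact: cg].
  - by move=> t t0; apply: is_deriveD; [exact: dF|exact: dG].
  - exact: cvgD.
  - exact: cvgD.
transitivity (\int[mu]_(t in `]0, +oo[) ((f + g) t - g t)).
  by apply: eq_Rintegral => t _; rewrite /= addrK.
by rewrite RintegralB// intfg intg; ring.
Qed.

End FTC_dominated.

(** * The integrand of Gamma and an integrable majorant *)

Section integrand.
Context {R : realType}.
Notation mu := (@lebesgue_measure R).
Implicit Types p q s t x : R.

Definition gamma_integrand x t := t `^ (x - 1) * expR (- t).

(** This is [s / q <= expR (s / q)] raised to the power [q]. *)
Lemma powR_le_expR q s : 0 < q -> 0 < s -> s `^ q <= q `^ q * expR s.
Proof.
move=> q0 s0.
have -> : expR s = expR (s / q) `^ q by rewrite -expRM divfK// gt_eqF.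
rewrite -powRM ?expR_ge0 ?(ltW q0)//.
apply: ge0_ler_powR; rewrite ?nnegrE ?mulr_ge0 ?expR_ge0 ?(ltW q0) ?(ltW s0)//.
rewrite -ler_pdivrMl// mulrC.
by apply: le_trans (expR_ge1Dx _); rewrite ler_wpDl.
Qed.

(* The derivative of the bounded increasing function [(t / (1 + t)) `^ p]. *)
Definition envelope p t := p * (t / (1 + t)) `^ (p - 1) / (1 + t) ^+ 2.

Lemma is_derive_envelope p t : 0 < t ->
  is_derive t 1 (fun t => (t / (1 + t)) `^ p) (envelope p t).
Proof.
move=> t0.
have t1 : 1 + t != 0 by rewrite gt_eqF// addr_gt0.
have d1 : is_derive t 1 (fun t : R => t / (1 + t)) ((1 + t) ^- 2).
  have d2 : is_derive t 1 (fun t : R => 1 + t) 1.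
    by rewrite -[X in is_derive _ _ _ X]add0r; apply: is_deriveD.
  have d3 := @is_deriveV R (fun t : R => 1 + t) t 1 1 t1 d2.
  have d4 := is_deriveM (@is_derive_id _ _ t 1) d3.
  by refine (is_derive_eq d4 _); rewrite /GRing.scale/=; field; exact: t1.
have tt : 0 < t / (1 + t) by rewrite divr_gt0// addr_gt0.
have d4 := @is_derive1_powR _ p _ tt.
have d5 := @is_derive1_comp R (fun y : R => y `^ p) (fun t => t / (1 + t)) t _ _ d4 d1.
exact: d5.
Qed.

(** Comparing [t^(p-1) e^(-t)] with [envelope p t] amounts to bounding [(1 + t)^(p+1)] by a multiple
    of [e^t]; [powR_le_expR] at [1 + t] with exponent [p + 1] gives the constant, and [/ p] cancels
    the leading factor of [envelope]. *)
Definition envelope_const p : R := (p + 1) `^ (p + 1) * expR 1 / p.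

Lemma gamma_integrand_ge0 p t : 0 <= gamma_integrand p t.
Proof. by rewrite mulr_ge0 ?powR_ge0 ?expR_ge0. Qed.

Lemma gamma_integrand_le_envelope p t : 0 < p -> 0 < t ->
  gamma_integrand p t <= envelope_const p * envelope p t.
Proof.
move=> p0 t0; rewrite /gamma_integrand /envelope_const /envelope.
have s0 : 0 < 1 + t by rewrite addr_gt0.
have := powR_le_expR (addr_gt0 p0 ltr01) s0.
rewrite (_ : p + 1 = (p - 1) + 2%:R); last by ring.
rewrite {1}powRD; last by rewrite (gt_eqF s0) implybT.
rewrite powR_mulrn ?(ltW s0)// expRD.
rewrite powRM ?invr_ge0 ?(ltW t0) ?(ltW s0)//.
rewrite -[(1 + t)^-1]powR_inv1 ?(ltW s0)// -powRrM mulN1r powRN expRN.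
have a0 : 0 < t `^ (p - 1) by rewrite powR_gt0.
have b0 : 0 < (1 + t) `^ (p - 1) by rewrite powR_gt0.
have E0 := expR_gt0 t.
move: (_ `^ (p - 1 + 2%:R)) (t `^ _) ((1 + t) `^ _) (expR t) (expR 1) a0 b0 E0.
move=> K a b E e a0 b0 E0 H.
rewrite ler_pdivrMr//.
have -> : K * e / p * (p * (a / b) / (1 + t) ^+ 2) * E =
  a * (K * (e * E) / (b * (1 + t) ^+ 2)).
  by field; rewrite !gt_eqF.
by rewrite ler_peMr ?(ltW a0)// ler_pdivlMr ?mulr_gt0 ?exprn_gt0// mul1r.
Qed.

Lemma continuous_gamma_integrand p t : 0 < t ->
  {for t, continuous (gamma_integrand p)}.
Proof.
move=> t0; apply: (@continuousM _ _ (fun t : R => t `^ (p - 1)) (fun t => expR (- t))).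
  apply: differentiable_continuous; apply/derivable1_diffP; apply: ex_derive.
  exact: is_derive1_powR.
apply: continuous_comp; first exact: opp_continuous.
exact: continuous_expR.
Qed.

Lemma continuous_envelope p t : 0 < t -> {for t, continuous (envelope p)}.
Proof.
move=> t0; have t1 : 1 + t != 0 by rewrite gt_eqF// addr_gt0.
have c1 : {for t, continuous (fun t : R => (1 + t)^-1)}.
  apply: (@continuousV _ _ (fun t : R => 1 + t)) => //.
  by apply: continuousD => //; exact: cst_continuous.
have -> : envelope p = fun t => p * (t / (1 + t)) `^ (p - 1) * ((1 + t)^-1 * (1 + t)^-1).
  by apply/funext => s; rewrite /envelope -invfM -expr2.
apply: (@continuousM _ _ (fun t : R => p * (t / (1 + t)) `^ (p - 1))
  (fun t => (1 + t)^-1 * (1 + t)^-1)); last first.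
  exact: (@continuousM _ _ (fun t => (1 + t)^-1) (fun t => (1 + t)^-1)).
apply: (@continuousM _ _ (cst p)); first exact: cst_continuous.
apply: (@continuous_comp _ _ _ (fun t : R => t / (1 + t)) (fun t : R => t `^ (p - 1))).
  exact: (@continuousM _ _ id).
apply: differentiable_continuous; apply/derivable1_diffP; apply: ex_derive.
by apply: is_derive1_powR; rewrite divr_gt0// addr_gt0.
Qed.

Lemma cvg_cst_div_pinfty (c : R) : (fun t => c / t) t @[t --> +oo] --> (0 : R).
Proof.
apply/cvgrPdist_le => e e0; near=> t.
have t0 : 0 < t by near: t; exact: nbhs_pinfty_gt.
rewrite sub0r normrN normrM normfV (gtr0_norm t0) ler_pdivrMr//.
by rewrite -ler_pdivrMl.
Unshelve. all: by end_near. Qed.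

Lemma cvg_powR_expRN0 p : 0 < p -> (t `^ p * expR (- t)) @[t --> 0^'+] --> (0 : R).
Proof.
move=> p0; apply: (squeeze_cvgr (f := cst 0) (h := fun t => t `^ p));
  [|exact: cvg_cst|exact: powR_cvg0].
near=> t; rewrite mulr_ge0 ?powR_ge0 ?expR_ge0//=.
by rewrite ler_piMr ?powR_ge0// expR_le1 oppr_le0.
Unshelve. all: by end_near. Qed.

(** Using [powR_le_expR] with exponent [p + 1] instead of [p] gains a factor [1 / t]. *)
Lemma cvg_powR_expRNy p : 0 < p -> (t `^ p * expR (- t)) @[t --> +oo] --> (0 : R).
Proof.
move=> p0.
apply: (squeeze_cvgr (f := cst 0) (h := fun t => (p + 1) `^ (p + 1) / t));
  [|exact: cvg_cst|exact: cvg_cst_div_pinfty].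
near=> t; have t0 : 0 < t by near: t; exact: nbhs_pinfty_gt.
rewrite mulr_ge0 ?powR_ge0 ?expR_ge0//= expRN ler_pdivrMr ?expR_gt0//.
rewrite mulrAC ler_pdivlMr//.
apply: le_trans (powR_le_expR (addr_gt0 p0 ltr01) t0).
rewrite powRD; last by rewrite (gt_eqF t0) implybT.
by rewrite powRr1// ltW.
Unshelve. all: by end_near. Qed.

Lemma cvg_envelope0 p : 0 < p -> ((t / (1 + t)) `^ p) @[t --> 0^'+] --> (0 : R).
Proof.
move=> p0; apply: (squeeze_cvgr (f := cst 0) (h := fun t => t `^ p));
  [|exact: cvg_cst|exact: powR_cvg0].
near=> t; rewrite powR_ge0/=.
have t0 : 0 < t by [].
have s0 : 0 < 1 + t by rewrite addr_gt0.
apply: ge0_ler_powR; rewrite ?nnegrE ?(ltW p0) ?divr_ge0 ?(ltW t0) ?(ltW s0)//.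
by rewrite ler_pdivrMr// ler_peMr ?(ltW t0)// lerDl ltW.
Unshelve. all: by end_near. Qed.

(** Squeezed between [1 - p / t] and 1: the logarithm is [- p ln (1 + 1/t) >= - p / t], and
    [e^y >= 1 + y]. *)
Lemma cvg_envelopey p : 0 < p -> ((t / (1 + t)) `^ p) @[t --> +oo] --> (1 : R).
Proof.
move=> p0.
have cvgl : (1 - p / t) @[t --> +oo] --> (1 : R).
  rewrite -[X in _ --> X]subr0; apply: cvgB; first exact: cvg_cst.
  exact: cvg_cst_div_pinfty.
apply: (squeeze_cvgr (f := fun t => 1 - p / t) (h := cst 1));
  [|exact: cvgl|exact: cvg_cst].
near=> t; have t0 : 0 < t by near: t; exact: nbhs_pinfty_gt.
have s0 : 0 < 1 + t by rewrite addr_gt0.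
have r0 : 0 < t / (1 + t) by rewrite divr_gt0.
rewrite /powR gt_eqF//; apply/andP; split.
  apply: le_trans (expR_ge1Dx _).
  rewrite lerD2l -mulrN ler_pM2l// lerNl -lnV ?posrE// invf_div.
  rewrite mulrDl mul1r divff ?gt_eqF// addrC le_ln1Dx//.
  by rewrite (@lt_trans _ _ 0)// ?ltrN10// invr_gt0.
rewrite expR_le1 pmulr_rle0// ln_le0// ler_pdivrMr// mul1r.
by rewrite lerDr.
Unshelve. all: by end_near. Qed.

Lemma integrable_gamma_integrand p : 0 < p ->
  mu.-integrable `]0, +oo[ (EFin \o gamma_integrand p).
Proof.
move=> p0.
have e0 t : 0 < t -> 0 <= envelope p t.
  by move=> t0; rewrite divr_ge0 ?exprn_ge0 ?mulr_ge0 ?powR_ge0 ?addr_ge0 ?ltW.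
have [ie _] := ge0_continuous_FTC2_0y_integrable e0 (@continuous_envelope p)
  (@is_derive_envelope p) (cvg_envelope0 p0) (cvg_envelopey p0).
have ize : mu.-integrable `]0, +oo[
    (fun t => ((envelope_const p)%:E * (envelope p t)%:E)%E).
  exact: integrableZl.
apply: (le_integrable _ _ _ ize) => //.
- apply/measurable_EFinP; apply: measurable_fun_continuous_0y.
  exact: continuous_gamma_integrand.
- move=> t; rewrite /= in_itv/= andbT => t0.
  rewrite lee_fin ger0_norm ?gamma_integrand_ge0//.
  by apply: le_trans (ler_norm _); exact: gamma_integrand_le_envelope.
Qed.

End integrand.

(** * Functional equation and positivity of Gamma *)

Section Gamma_facts.
Context {R : realType}.
Notation mu := (@lebesgue_measure R).
Implicit Types p q s t x : R.

(** Integration by parts in one step: [t^x e^(-t)] vanishes at both ends and has derivative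
    [x t^(x-1) e^(-t) - t^x e^(-t)]. This changes sign, so a combination of two envelopes dominates
    it. *)
Lemma GammaD1 x : 0 < x -> Gamma (x + 1) = x * Gamma x.
Proof.
move=> x0; have x10 : 0 < x + 1 by rewrite addr_gt0.
have intx := integrable_gamma_integrand x0.
have intx1 := integrable_gamma_integrand x10.
pose c := x * envelope_const x; pose c' := envelope_const (x + 1).
pose env p t : R := (t / (1 + t)) `^ p.
have : \int[mu]_(t in `]0, +oo[)
    (x * gamma_integrand x t - gamma_integrand (x + 1) t) = 0 - 0.
  apply: (@dominated_FTC2_0y _ _ (fun t => t `^ x * expR (- t))
    (fun t => c * envelope x t + c' * envelope (x + 1) t)
    (c \*: env x + c' \*: env (x + 1)) _ _ (c * 0 + c' * 0) (c * 1 + c' * 1)).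
  - move=> t t0; apply: le_trans (ler_normB _ _) _.
    rewrite (ger0_norm (gamma_integrand_ge0 (x + 1) t)).
    rewrite (ger0_norm (mulr_ge0 (ltW x0) (gamma_integrand_ge0 x t))).
    rewrite lerD// ?gamma_integrand_le_envelope//.
    by rewrite /c -mulrA ler_pM2l// gamma_integrand_le_envelope.
  - move=> t t0.
    apply: (@continuousB _ _ _ (fun t => x * gamma_integrand x t)).
      apply: (@continuousM _ _ (cst x)); first exact: cst_continuous.
      exact: continuous_gamma_integrand.
    exact: continuous_gamma_integrand.
  - move=> t t0.
    apply: (@continuousD _ _ _ (fun t => c * envelope x t)
      (fun t => c' * envelope (x + 1) t)).
      apply: (@continuousM _ _ (cst c)); first exact: cst_continuous.
      exact: continuous_envelope.
    apply: (@continuousM _ _ (cst c')); first exact: cst_continuous.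
    exact: continuous_envelope.
  - move=> t t0.
    have d1 := is_derive1_powR x t0.
    have d2 : is_derive t 1 (fun t => expR (- t)) (expR (- t) * -1).
      exact: (@is_derive1_comp R expR (fun t => - t)).
    refine (is_derive_eq (is_deriveM d1 d2) _).
    by rewrite /GRing.scale/= /gamma_integrand addrK; ring.
  - move=> t t0.
    have d1 := @is_derive_envelope R x _ t0.
    have d2 := @is_derive_envelope R (x + 1) _ t0.
    exact: is_deriveD.
  - exact: cvg_powR_expRN0.
  - exact: cvg_powR_expRNy.
  - apply: cvgD; apply: cvgM; rewrite ?cvg_envelope0//; try exact: cvg_cst.
      exact: cvg_envelope0.
    exact: cvg_envelope0.
  - apply: cvgD; apply: cvgM; try exact: cvg_cst.
      exact: cvg_envelopey.
    exact: cvg_envelopey.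
rewrite RintegralB//; last first.
  exact: (@integrableZl _ _ _ mu _ _ x (EFin \o gamma_integrand x)).
rewrite RintegralZl// subr0 => /eqP; rewrite subr_eq0 => /eqP.
by move=> ->.
Qed.

Lemma Gamma_gt0 x : 0 < x -> 0 < Gamma x.
Proof.
move=> x0; have intx := integrable_gamma_integrand x0.
(* A lower bound of the integrand on [[1, 2]], an interval of length 1: there [t <= 2] and
   [0 <= ln t <= 1]. *)
pose c : R := expR (- (`|x - 1| + 2)).
have c0 : 0 < c by exact: expR_gt0.
have mg := measurable_fun_continuous_0y (@continuous_gamma_integrand R x).
have lec : (c%:E <= \int[mu]_(t in `]0%R, +oo[) (gamma_integrand x t)%:E)%E.
  apply: (@le_trans _ _ (\int[mu]_(t in `[1%R, 2%R]) (gamma_integrand x t)%:E)%E).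
    have -> : (c%:E = \int[mu]_(t in `[1%R, 2%R]) c%:E)%E.
      rewrite integral_cst//= lebesgue_measure_itv/= lte_fin.
      rewrite ltr1n -EFinB/= -EFinM; congr EFin; ring.
    apply: ge0_le_integral => //.
    - by move=> t _; rewrite lee_fin ltW.
    - apply/measurable_EFinP; apply: measurable_funS mg => //.
      by move=> t; rewrite /= !in_itv/= andbT => /andP[+ _]; exact: lt_le_trans.
    - move=> t; rewrite /= in_itv/= => /andP[t1 t2]; rewrite lee_fin.
      have t0 : 0 < t by exact: lt_le_trans t1.
      rewrite /c /gamma_integrand /powR gt_eqF// -expRD ler_expR opprD lerD//;
        last by rewrite lerN2.
      rewrite lerNl -mulNr; apply: le_trans (ler_norm _) _.
      rewrite normrM normrN ler_piMr//.
      rewrite ger0_norm ?ln_ge0//.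
      have := @le_ln1Dx R (t - 1).
      rewrite (_ : 1 + (t - 1) = t) => [H|]; last by ring.
      by apply: le_trans (H _) _; lra.
  apply: ge0_subset_integral => //.
  - exact/measurable_EFinP.
  - by move=> t _; rewrite lee_fin gamma_integrand_ge0.
  - by move=> t; rewrite /= !in_itv/= andbT => /andP[+ _]; exact: lt_le_trans.
(* [Rintegral] would turn an infinite integral into 0, so finiteness is needed to carry the bound
   over. *)
apply: lt_le_trans c0 _; rewrite -lee_fin.
apply: le_trans lec _; rewrite /Gamma /Rintegral fineK//.
exact: (integrable_fin_num _ intx).
Qed.

Lemma ln_GammaD1 x : 0 < x -> ln (Gamma (x + 1)) = ln (Gamma x) + ln x.
Proof.
by move=> x0; rewrite GammaD1// lnM ?posrE ?Gamma_gt0// addrC.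
Qed.

End Gamma_facts.

(** * Logarithmic convexity of Gamma *)

Section Gamma_convex.
Context {R : realType}.
Notation mu := (@lebesgue_measure R).
Implicit Types x s t a b l m : R.

Let expR_weighted_le l m a b : 0 <= l -> 0 <= m -> l + m = 1 ->
  expR (l * a + m * b) <= l * expR a + m * expR b.
Proof.
move=> l0 m0 lm.
have l1 : l <= 1 by rewrite -lm lerDl.
have -> : m = 1 - l by rewrite -lm addrC addKr.
exact: (@convex_expR R (Itv01 l0 l1) a b).
Qed.

(* Weighted AM-GM applied to the two integrands, each normalised to have
   integral 1. *)
Lemma ln_Gamma_convex x s t : 0 < x -> 0 < s -> 0 < t ->
  (s + t) * ln (Gamma (x + s)) <=
  t * ln (Gamma x) + s * ln (Gamma (x + s + t)).
Proof.
move=> x0 s0 t0.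
have xs0 : 0 < x + s by rewrite addr_gt0.
have xst0 : 0 < x + s + t by rewrite addr_gt0.
have st0 : 0 < s + t by rewrite addr_gt0.
(* The weights for which [x + s = l x + m (x + s + t)]. *)
have [l [m [l0 m0 lm lE mE]]] : exists l m, [/\ 0 <= l, 0 <= m, l + m = 1,
    (s + t) * l = t & (s + t) * m = s].
  by exists (t / (s + t)), (s / (s + t)); split;
    rewrite ?divr_ge0 ?(ltW t0) ?(ltW s0) ?(ltW st0)//; field; rewrite gt_eqF.
have GA : Gamma x = expR (ln (Gamma x)) by rewrite lnK// posrE Gamma_gt0.
have GB : Gamma (x + s + t) = expR (ln (Gamma (x + s + t))).
  by rewrite lnK// posrE Gamma_gt0.
move: (ln (Gamma x)) (ln (Gamma (x + s + t))) GA GB => A B GA GB.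
have ix := integrable_gamma_integrand x0.
have ixs := integrable_gamma_integrand xs0.
have ixst := integrable_gamma_integrand xst0.
have iZ p k : mu.-integrable `]0, +oo[ (EFin \o gamma_integrand p) ->
    mu.-integrable `]0, +oo[ (EFin \o (fun u => k * gamma_integrand p u)).
  move=> ip; exact: (@integrableZl _ _ _ mu _ _ k (EFin \o gamma_integrand p)).
have H : expR (- (l * A + m * B)) * Gamma (x + s) <= 1.
  have -> : 1 = l * expR (- A) * Gamma x + m * expR (- B) * Gamma (x + s + t).
    by rewrite GA GB -!mulrA -!expRD !addNr expR0 !mulr1.
  rewrite /Gamma -!RintegralZl// -RintegralD//; [|exact: iZ|exact: iZ].
  apply: le_Rintegral => //.
  - exact: iZ.
  - exact: (integrableD _ (iZ _ (l * expR (- A)) ix) (iZ _ (m * expR (- B)) ixst)).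
  move=> u; rewrite /= in_itv/= andbT => u0.
  rewrite /powR gt_eqF// -!expRD -!mulrA -!expRD.
  have -> : - (l * A + m * B) + ((x + s - 1) * ln u - u) =
      l * (- A + ((x - 1) * ln u - u)) + m * (- B + ((x + s + t - 1) * ln u - u)).
    (* With [w = s + t], the identity of exponents becomes polynomial. *)
    have [w [-> ->]] : exists w, s = w * m /\ t = w * l.
      by exists (s + t); rewrite lE mE.
    have -> : m = 1 - l by rewrite -lm addrC addKr.
    by ring.
  exact: expR_weighted_le.
have {}H : ln (Gamma (x + s)) <= l * A + m * B.
  rewrite -ler_expR lnK ?posrE ?Gamma_gt0//.
  by move: H; rewrite expRN mulrC ler_pdivrMr ?expR_gt0// mul1r.
have -> : t * A + s * B = (s + t) * (l * A + m * B).
  by rewrite mulrDr !mulrA lE mE.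
by rewrite ler_pM2l.
Qed.

End Gamma_convex.

(** * Differentiability from convexity and a shift equation, for [ln Gamma] and later for minus
    [digamma] *)

Section convex_shift.
Context {R : realType}.
Implicit Types (f phi c : R -> R) (x y s t h d e : R).

(** A quotient-free form of the derivative, valid also at [h = 0], which matches the linear
    inequalities supplied by convexity. *)
Lemma is_deriveP_eps f x d :
  is_derive x 1 f d <->
  forall e, 0 < e -> exists2 r, 0 < r &
    forall h, `|h| < r -> `|f (x + h) - f x - d * h| <= e * `|h|.
Proof.
split=> [[df dfE] e e0|H].
  have : h^-1 *: (f (h *: 1 + x) - f x) @[h --> 0^'] --> d by rewrite -dfE.
  move=> /cvgrPdist_le/(_ _ e0)[r /= r0 Hr]; exists r => // h hr.
  have [->|h0] := eqVneq h 0.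
    by rewrite addr0 subrr mulr0 subrr !normr0 mulr0.
  have := Hr h; rewrite /ball_/= sub0r normrN => /(_ hr h0).
  rewrite /GRing.scale/= mulr1 (addrC h).
  have -> : d - h^-1 * (f (x + h) - f x) = - (f (x + h) - f x - d * h) / h.
    by field.
  by rewrite normrM normrN normfV ler_pdivrMr ?normr_gt0.
have cv : h^-1 *: (f (h *: 1 + x) - f x) @[h --> 0^'] --> d.
  apply/cvgrPdist_le => e e0; have [r r0 Hr] := H e e0.
  exists r => //= h; rewrite /ball_/= sub0r normrN => hr h0.
  rewrite /GRing.scale/= mulr1 (addrC h).
  have -> : d - h^-1 * (f (x + h) - f x) = - (f (x + h) - f x - d * h) / h.
    by field.
  by rewrite normrM normrN normfV ler_pdivrMr ?normr_gt0// Hr.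
by apply: DeriveDef; [apply: cvgP cv|exact: cvg_lim cv].
Qed.

Variables phi c : R -> R.
Hypothesis phi_convex : forall x s t, 0 < x -> 0 < s -> 0 < t ->
  (s + t) * phi (x + s) <= t * phi x + s * phi (x + s + t).
Hypothesis phiD1 : forall x, 0 < x -> phi (x + 1) = phi x + c x.
Hypothesis derivable_c : forall x, 0 < x -> derivable c x 1.
Hypothesis c_increment : forall x, 0 < x -> c (x + 1) - c x <= x^-1.

(** [C x] is the sum of [c (x + k)] over [k < n]. *)
Let shift_derivable n : exists2 C : R -> R, (forall x, 0 < x -> derivable C x 1) &
  (forall x, 0 < x -> phi (x + n%:R) = phi x + C x).
Proof.
elim: n => [|n [C dC HC]].
  by exists (cst 0) => // x x0; rewrite !addr0.
exists (C + (c \o (fun x => x + n%:R))) => x x0.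
  have xn0 : 0 < x + n%:R by rewrite ltr_wpDr.
  apply: derivableD; first exact: dC.
  have d1 : is_derive x 1 (fun x => x + n%:R) (1 + 0) by apply: is_deriveD.
  have d2 := derivableP (derivable_c xn0).
  by have [] := @is_derive1_comp R c (fun x => x + n%:R) _ _ _ d2 d1.
by rewrite -natr1 addrA phiD1 ?HC ?addrA// ltr_wpDr.
Qed.

(* [phi (x + n) - phi x] is differentiable at [x], and the slopes of [phi] at
   [x + n] lie between [c (x + n - 1)] and [c (x + n)]. *)
Let second_difference x e : 0 < x -> 0 < e ->
  (* The index [n] makes [1 / (x + n - 1) <= e / 2]. The other half of [e] pays for the remainders
     of [C] at [h] and [- h], each at most [e / 4 * h]. *)
  exists2 h, 0 < h < x & phi (x + h) + phi (x - h) - 2 * phi x <= e * h.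
Proof.
move=> x0 e0; pose n := (Num.bound (2 / e)).+1.
have e20 : 0 < e / 2 by rewrite divr_gt0.
have n1 : 1 <= n%:R :> R by rewrite ler1n.
have z0 : 0 < x + n%:R by lra.
have z1 : 0 < x + n%:R - 1 by lra.
have nP : (x + n%:R - 1)^-1 <= e / 2.
  have H : 2 / e < (Num.bound (2 / e))%:R by rewrite archi_boundP// divr_ge0// ltW.
  rewrite invf_ple ?posrE// invf_div /n -natr1; lra.
have [C dC HC] := shift_derivable n.
have [r r0 Hr] := (is_deriveP_eps C x _).1 (derivableP (dC x x0)) _
  (divr_gt0 e20 (ltr0Sn R 1)).
pose h := Num.min (r / 2) (Num.min (x / 2) (1 / 2)).
have h0 : 0 < h by rewrite !lt_min !divr_gt0.
have hr : h < r.
  by apply: (@le_lt_trans _ _ (r / 2)); [rewrite ge_min lexx|lra].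
have hx : h < x.
  by apply: (@le_lt_trans _ _ (x / 2)); [rewrite !ge_min lexx orbT|lra].
have h1 : h < 1.
  by apply: (@le_lt_trans _ _ (1 / 2)); [rewrite !ge_min lexx !orbT|lra].
clearbody h n.
exists h; first by rewrite h0.
have Hp := Hr h; have Hm := Hr (- h).
move: Hp Hm; rewrite normrN (gtr0_norm h0) => /(_ hr) + /(_ hr).
rewrite !ler_norml => /andP[Hp _] /andP[Hm _].
have E1 := HC (x + h) (addr_gt0 x0 h0).
have E2 : phi (x - h + n%:R) = phi (x - h) + C (x - h) by rewrite HC// subr_gt0.
have E3 := HC x x0.
have h1' : 0 < 1 - h by rewrite subr_gt0.
(* [K1] bounds the right slope at [x + n] above by the increment over [[x + n, x + n + 1]]; [K2]
   bounds the left slope below by the increment over [[x + n - 1, x + n]]. *)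
have K1 := phi_convex z0 h0 h1'.
have K2 := phi_convex z1 h1' h0.
have K4 := phiD1 z1.
have K5 := c_increment z1.
rewrite (_ : x + n%:R + h + (1 - h) = x + n%:R + 1) in K1; last by ring.
rewrite (_ : x + n%:R + h = x + h + n%:R) in K1; last by ring.
rewrite (_ : x + n%:R - 1 + (1 - h) + h = x + n%:R) in K2; last by ring.
rewrite (_ : x + n%:R - 1 + (1 - h) = x - h + n%:R) in K2; last by ring.
rewrite subrK in K4 K5.
have K6 : h * (c (x + n%:R) - c (x + n%:R - 1)) <= h * (e / 2).
  by rewrite ler_pM2l//; apply: le_trans K5 _.
rewrite phiD1// E1 in K1.
have {}K4 : phi (x + n%:R - 1) = phi (x + n%:R) - c (x + n%:R - 1).
  by rewrite K4 addrK.
rewrite K4 E2 in K2; rewrite E3 in K1 K2.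
move: ('D_1 C x) Hp Hm => D Hp Hm.
move: (phi (x + h)) (phi (x - h)) (phi x) (C (x + h)) (C (x - h)) (C x)
  (c (x + n%:R)) (c (x + n%:R - 1)) K1 K2 K6 Hp Hm => *; lra.
Qed.

(** The supremum [d] of the left slopes is at most every right slope, so the line of slope [d]
    through the point at [x] supports the graph. By [second_difference], [phi] exceeds this line by
    at most [e k] at the two points at some distance [k], since it lies above the line at both;
    convexity scales this to [e |h|] for all [|h| < k]. *)
Lemma convex_shift_derivable x : 0 < x ->
  derivable phi x 1 /\
  (forall y, 0 < y -> phi x + 'D_1 phi x * (y - x) <= phi y).
Proof.
move=> x0.
pose L : set R := [set l | exists2 h, 0 < h < x & l = (phi x - phi (x - h)) / h].
have Lub k : 0 < k -> ubound L ((phi (x + k) - phi x) / k).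
  move=> k0 _ [h /andP[h0 hx] ->].
  rewrite ler_pdivrMr// mulrAC ler_pdivlMr//.
  have xh0 : 0 < x - h by rewrite subr_gt0.
  have := phi_convex xh0 h0 k0; rewrite subrK.
  move: (phi x) (phi (x - h)) (phi (x + k)) => *; lra.
have L0 : L !=set0.
  by exists ((phi x - phi (x - x / 2)) / (x / 2)); exists (x / 2) => //; lra.
pose d := sup L.
have right_le k : 0 < k -> d * k <= phi (x + k) - phi x.
  by move=> k0; rewrite -ler_pdivlMr//; apply: ge_sup => //; exact: Lub.
have left_le h : 0 < h -> h < x -> phi x - phi (x - h) <= d * h.
  move=> h0 hx; rewrite -ler_pdivrMr//; apply: ub_le_sup.
    by exists ((phi (x + 1) - phi x) / 1); exact: Lub.
  by exists h => //; rewrite h0.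
have dphi : is_derive x 1 phi d.
  apply/is_deriveP_eps => e e0.
  have [k /andP[k0 kx] Hk] := second_difference x0 e0.
  have Rk := right_le k k0; have Lk := left_le k k0 kx.
  exists k => // h hk.
  have [h0|h0|->] := ltgtP h 0; last by rewrite addr0 subrr mulr0 subrr !normr0 mulr0.
  - rewrite ltr0_norm// in hk *.
    have mh0 : 0 < - h by rewrite oppr_gt0.
    have kh0 : 0 < k + h by rewrite -(opprK h) subr_gt0.
    have xk0 : 0 < x - k by rewrite subr_gt0.
    have Lh := left_le (- h) mh0 (lt_trans hk kx).
    have C1 := phi_convex xk0 kh0 mh0.
    rewrite opprK in Lh.
    rewrite (_ : x - k + (k + h) = x + h) in C1; last by ring.
    rewrite !addrK in C1.
    rewrite ler_norml; apply/andP; split; last first.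
      rewrite -(ler_pM2l k0).
      have := ler_wpM2l (ltW mh0) Hk; have := ler_wpM2l (ltW mh0) Rk.
      move: (phi x) (phi (x + h)) (phi (x - k)) (phi (x + k)) C1.
      move: (d) => D => *; lra.
    have : 0 <= e * - h by rewrite mulr_ge0 ?ltW.
    by move: (phi x) (phi (x + h)) Lh => *; lra.
  - rewrite gtr0_norm// in hk *.
    have Rh := right_le h h0.
    have kh0 : 0 < k - h by rewrite subr_gt0.
    have C1 := phi_convex x0 h0 kh0.
    rewrite (_ : x + h + (k - h) = x + k) in C1; last by ring.
    rewrite ler_norml; apply/andP; split; last first.
      rewrite -(ler_pM2l k0).
      have := ler_wpM2l (ltW h0) Hk; have := ler_wpM2l (ltW h0) Lk.
      move: (phi x) (phi (x + h)) (phi (x - k)) (phi (x + k)) C1.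
      move: (d) => D => *; lra.
    have : 0 <= e * h by rewrite mulr_ge0 ?ltW.
    by move: (phi x) (phi (x + h)) Rh => *; lra.
split; first exact: ex_derive.
move=> y y0; rewrite (@derive_val _ _ _ _ _ _ _ dphi).
have [yx|yx|->] := ltgtP y x; last by rewrite subrr mulr0 addr0.
- have yx0 : 0 < x - y by rewrite subr_gt0.
  have := left_le (x - y) yx0; rewrite subKr.
  by move: (d) => D /(_ ltac:(lra)); lra.
- have yx0 : 0 < y - x by rewrite subr_gt0.
  by have := right_le (y - x) yx0; rewrite subrKC; lra.
Qed.

End convex_shift.

(** * Telescoping positivity, and bounds for [digamma] and [trigamma] *)

Section digamma.
Context {R : realType}.
Implicit Types (f c : R -> R) (x y s t u v : R).

(** The second hypothesis, [f x >= - C / x], keeps the limit at infinity from being negative. A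
    value [f x < 0] would persist at all [x + n] and make [(x + n) f (x + n)] drop below [- C];
    strict positivity follows by one more shift. *)
Lemma gt0_of_decreasing_shift f (C : R) :
  (forall x, 0 < x -> f (x + 1) < f x) ->
  (forall x, 1 <= x -> - C <= x * f x) ->
  forall x, 0 < x -> 0 < f x.
Proof.
move=> fdec flow.
suff f_ge0 x : 0 < x -> 0 <= f x.
  by move=> x x0; apply: le_lt_trans (fdec x x0); rewrite f_ge0 ?addr_gt0.
move=> x0; rewrite leNgt; apply/negP => fx0.
have fle n : f (x + n%:R) <= f x.
  elim: n => [|n IH]; first by rewrite addr0.
  apply: le_trans IH; rewrite -natr1 addrA ltW// fdec// ltr_wpDr//.
pose n := (Num.bound (`|C| / - f x)).+1.
have nfx0 : 0 < - f x by rewrite oppr_gt0.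
have n1 : 1 <= n%:R :> R by rewrite ler1n.
have CB : C < n%:R * - f x.
  apply: le_lt_trans (ler_norm C) _; rewrite -ltr_pdivrMr//.
  apply: (@lt_trans _ _ (Num.bound (`|C| / - f x))%:R); last by rewrite ltr_nat.
  by rewrite archi_boundP// divr_ge0// ltW.
have xn1 : 1 <= x + n%:R by lra.
have xn0 : 0 <= x + n%:R by lra.
have := flow _ xn1.
have := ler_wpM2l xn0 (fle n).
have : x * f x <= 0 by rewrite nmulr_lle0// ltW.
lra.
Qed.

Lemma near_gt0 x : 0 < x -> \forall y \near x, 0 < y.
Proof. by move=> x0; exact: lt_nbhsr. Qed.

Lemma derive_shift f c x dc : 0 < x ->
  (forall y, 0 < y -> f (y + 1) = f y + c y) ->
  derivable f x 1 -> derivable f (x + 1) 1 -> is_derive x 1 c dc ->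
  'D_1 f (x + 1) = 'D_1 f x + dc.
Proof.
move=> x0 fS /derivableP dfx /derivableP dfx1 dcx.
have d1 : is_derive x 1 (fun y => y + 1) (1 + 0) by apply: is_deriveD.
have d2 := @is_derive1_comp R f (fun y => y + 1) _ _ _ dfx1 d1.
have d3 := is_deriveD dfx dcx.
have d4 : is_derive x 1 (f \o (fun y => y + 1)) ('D_1 f x + dc).
  apply: near_eq_is_derive d3.
  by apply: filterS (near_gt0 x0) => y y0; rewrite /= fS.
by have := @derive_val _ _ _ _ _ _ _ d4; rewrite (@derive_val _ _ _ _ _ _ _ d2) addr0 mulr1.
Qed.

Lemma le_ln_sub x y : 0 < x -> 0 < y -> ln y - ln x <= (y - x) / x.
Proof.
move=> x0 y0; rewrite -ln_div ?posrE//.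
have -> : y / x = 1 + (y - x) / x by field; rewrite gt_eqF.
rewrite le_ln1Dx// mulrBl divff ?gt_eqF// ltrBrDr addrC subrr.
by rewrite divr_gt0.
Qed.

Let lnG x := ln (Gamma x).

Lemma ln_Gamma_derivable x : 0 < x ->
  derivable lnG x 1 /\
  (forall y, 0 < y -> lnG x + 'D_1 lnG x * (y - x) <= lnG y).
Proof.
move=> x0; apply: (@convex_shift_derivable R lnG (@ln R)) => //.
- exact: ln_Gamma_convex.
- exact: ln_GammaD1.
- by move=> y y0; apply: ex_derive; exact: is_derive1_ln.
- move=> y y0; apply: le_trans (le_ln_sub y0 (addr_gt0 y0 ltr01)) _.
  by rewrite (addrC y) addrK mul1r.
Qed.

(** Differentiability is known for [ln Gamma] first; it passes to Gamma through
    [Gamma = exp (ln Gamma)] near [x]. *)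
Lemma digammaE x : 0 < x -> digamma x = 'D_1 lnG x.
Proof.
move=> x0; have [dL _] := ln_Gamma_derivable x0.
have G0 := Gamma_gt0 x0.
have d1 := @is_derive1_comp R expR lnG x _ _ (is_derive_expR _) (derivableP dL).
have d2 : is_derive x 1 (@Gamma R) (expR (lnG x) * 'D_1 lnG x).
  apply: near_eq_is_derive d1.
  by apply: filterS (near_gt0 x0) => y y0; rewrite /= lnK// posrE Gamma_gt0.
rewrite /digamma derive1E (@derive_val _ _ _ _ _ _ _ d2) lnK ?posrE//.
by rewrite mulrAC divff ?mul1r// gt_eqF.
Qed.

Lemma digammaD1 x : 0 < x -> digamma (x + 1) = digamma x + x^-1.
Proof.
move=> x0; have x10 : 0 < x + 1 by rewrite addr_gt0.
rewrite !digammaE//; apply: derive_shift (is_derive1_ln x0) => //.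
- exact: ln_GammaD1.
- exact: (ln_Gamma_derivable x0).1.
- exact: (ln_Gamma_derivable x10).1.
Qed.

Lemma ln_Gamma_tangent x y : 0 < x -> 0 < y ->
  ln (Gamma x) + digamma x * (y - x) <= ln (Gamma y).
Proof. by move=> x0; rewrite (digammaE x0); exact: (ln_Gamma_derivable x0).2. Qed.

(** The tangent to [ln Gamma] at [x], read at [x + 1]; the companion lower bound reads the tangent
    at [x + 1] back at [x]. *)
Lemma digamma_le_ln x : 0 < x -> digamma x <= ln x.
Proof.
move=> x0; have := ln_Gamma_tangent x0 (addr_gt0 x0 ltr01).
rewrite (ln_GammaD1 x0).
by move: (ln (Gamma x)) (ln x) (digamma x) => a b c; lra.
Qed.

Lemma digamma_ge_ln x : 0 < x -> ln x - x^-1 <= digamma x.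
Proof.
move=> x0; have := ln_Gamma_tangent (addr_gt0 x0 ltr01) x0.
rewrite (ln_GammaD1 x0) (digammaD1 x0).
by move: (ln (Gamma x)) (ln x) (digamma x) x^-1 => a b c d; lra.
Qed.

(** Shifting by 1 lowers the concavity defect by exactly the convexity defect of [1 / x], which is
    positive. The logarithmic bounds on [digamma] keep the defect above [- (s + t) / (x + s)]. *)
Lemma digamma_concave x s t : 0 < x -> 0 < s -> 0 < t ->
  t * digamma x + s * digamma (x + s + t) <= (s + t) * digamma (x + s).
Proof.
move=> x0 s0 t0; rewrite -subr_ge0; apply/ltW; move: x x0.
apply: (@gt0_of_decreasing_shift (fun x => (s + t) * digamma (x + s) -
  (t * digamma x + s * digamma (x + s + t))) (s + t)) => x x0.
  have xs0 : 0 < x + s by rewrite addr_gt0.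
  have xst0 : 0 < x + s + t by rewrite addr_gt0.
  rewrite (_ : x + 1 + s = x + s + 1); last by ring.
  rewrite (_ : x + s + 1 + t = x + s + t + 1); last by ring.
  rewrite (digammaD1 x0) (digammaD1 xs0) (digammaD1 xst0).
  move: (digamma x) (digamma (x + s)) (digamma (x + s + t)) => a b c.
  have : 0 < t * x^-1 + s * (x + s + t)^-1 - (s + t) * (x + s)^-1.
    rewrite [ltRHS](_ : _ = s * t * (s + t) / (x * (x + s) * (x + s + t))).
      by rewrite divr_gt0 ?mulr_gt0 ?addr_gt0.
    by field; rewrite !gt_eqF.
  lra.
have {}x0 : 0 < x by exact: lt_le_trans x0.
have xs0 : 0 < x + s by rewrite addr_gt0.
have xst0 : 0 < x + s + t by rewrite addr_gt0.
have A1 := le_ln_sub xs0 x0; have A2 := le_ln_sub xs0 xst0.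
have B1 := digamma_le_ln x0; have B2 := digamma_le_ln xst0.
have B3 := digamma_ge_ln xs0.
have {}A1 := ler_wpM2l (ltW t0) A1; have {}A2 := ler_wpM2l (ltW s0) A2.
have {}B1 := ler_wpM2l (ltW t0) B1; have {}B2 := ler_wpM2l (ltW s0) B2.
have {}B3 := ler_wpM2l (ltW (addr_gt0 s0 t0)) B3.
(* The tangent terms of [ln] at [x + s] cancel, because [x + s] is the weighted mean of the outer
   points. *)
have A3 : t * ((x - (x + s)) / (x + s)) + s * ((x + s + t - (x + s)) / (x + s)) = 0.
  by field; rewrite gt_eqF.
move: (digamma x) (digamma (x + s)) (digamma (x + s + t)) B1 B2 B3.
move: (ln x) (ln (x + s)) (ln (x + s + t)) A1 A2 => a b c A1 A2 a' b' c' B1 B2 B3.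
have D : - ((s + t) * (x + s)^-1) <= (s + t) * b' -
    (t * a' + s * c') by lra.
apply: le_trans (ler_wpM2l (ltW x0) D).
rewrite mulrN lerN2 mulrCA ler_piMr ?addr_ge0 ?(ltW s0) ?(ltW t0)//.
by rewrite ler_pdivrMr// mul1r lerDl ltW.
Qed.

Lemma digamma_derivable x : 0 < x ->
  derivable (@digamma R) x 1 /\
  (forall y, 0 < y -> digamma y <= digamma x + trigamma x * (y - x)).
Proof.
move=> x0.
have [] := @convex_shift_derivable R (- @digamma R) (- GRing.inv) _ _ _ _ x x0.
- move=> y s t y0 s0 t0; have := digamma_concave y0 s0 t0.
  rewrite !fctE.
  by move: (digamma y) (digamma (y + s)) (digamma (y + s + t)) => a b d; lra.
- by move=> y y0; rewrite !fctE digammaD1// opprD.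
- move=> y y0; apply: derivableN; apply: ex_derive.
  by apply: (@is_deriveV R id y 1 1); rewrite gt_eqF.
- move=> y y0; rewrite !fctE opprK.
  by rewrite gerDr oppr_le0 invr_ge0 addr_ge0// ltW.
move=> dN sub.
have dd : derivable (@digamma R) x 1 by rewrite -[@digamma R]opprK; exact: derivableN.
split=> // y y0; have := sub y y0.
rewrite deriveN// /trigamma derive1E !fctE.
by move: (digamma y) (digamma x) ('D_1 _ x) => a b d; lra.
Qed.

Lemma trigammaD1 x : 0 < x -> trigamma (x + 1) = trigamma x - x ^- 2.
Proof.
move=> x0; have x10 : 0 < x + 1 by rewrite addr_gt0.
rewrite /trigamma !derive1E.
have d : is_derive x 1 (@GRing.inv R) (- x ^- 2).
  have H := @is_deriveV R id x 1 1 (lt0r_neq0 x0) (is_derive_id _ _).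
  by refine (is_derive_eq H _); rewrite /GRing.scale/= mulr1.
apply: derive_shift d => //.
- exact: digammaD1.
- exact: (digamma_derivable x0).1.
- exact: (digamma_derivable x10).1.
Qed.

(** By concavity, the tangent to [digamma] at [x] lies above its value at [x + 1]; [trigamma_le]
    uses the tangent at [x + 1] and the value at [x]. *)
Lemma trigamma_ge x : 0 < x -> x^-1 <= trigamma x.
Proof.
move=> x0; have := (digamma_derivable x0).2 _ (addr_gt0 x0 ltr01).
rewrite (digammaD1 x0).
by move: (digamma x) (trigamma x) x^-1 => a b c; lra.
Qed.

Lemma trigamma_le x : 0 < x -> trigamma x <= x^-1 + x ^- 2.
Proof.
move=> x0; have x10 : 0 < x + 1 by rewrite addr_gt0.
have := (digamma_derivable x10).2 _ x0.
rewrite (digammaD1 x0) (trigammaD1 x0).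
by move: (digamma x) (trigamma x) x^-1 (x ^- 2) => a b c d; lra.
Qed.

(** Telescoping in [u] with the gap [t = v - u] fixed. One shift changes [trigamma w - 1/w] by
    [d w = 1 / (w^2 (w + 1))], which decreases in [w]. *)
Lemma trigamma_sub_gt u v : 0 < u -> u < v ->
  u^-1 - v^-1 < trigamma u - trigamma v.
Proof.
move=> u0 uv; pose t := v - u.
have t0 : 0 < t by rewrite subr_gt0.
have -> : v = u + t by rewrite /t subrKC.
rewrite -subr_gt0; move: u u0 {uv} @t t0 => u u0 t t0.
clearbody t; move: u u0.
apply: (@gt0_of_decreasing_shift (fun u => trigamma u - trigamma (u + t) -
  (u^-1 - (u + t)^-1)) 3) => u u0.
  have ut0 : 0 < u + t by rewrite addr_gt0.
  have u10 : 0 < u + 1 by rewrite addr_gt0.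
  rewrite (_ : u + 1 + t = u + t + 1); last by ring.
  rewrite (trigammaD1 u0) (trigammaD1 ut0).
  move: (trigamma u) (trigamma (u + t)) => T T'.
  pose d (w : R) := w ^- 2 - w^-1 + (w + 1)^-1.
  have dE w : 0 < w -> d w = (w ^+ 2 * (w + 1))^-1.
    by move=> w0; rewrite /d; field; rewrite !gt_eqF// addr_gt0.
  have : d (u + t) < d u.
    rewrite !dE// ltf_pV2 ?posrE ?mulr_gt0 ?exprn_gt0 ?addr_gt0//.
    rewrite ltr_pM ?exprn_ge0 ?addr_ge0 ?(ltW u0)//; last by lra.
    by rewrite ltr_pXn2r ?nnegrE ?(ltW u0) ?(ltW ut0)// ltrDl.
  by rewrite /d; lra.
have u10 : 0 < u by exact: lt_le_trans u0.
have ut0 : 0 < u + t by rewrite addr_gt0.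
have A := trigamma_ge u10; have B := trigamma_le ut0.
move: (trigamma u) (trigamma (u + t)) A B => T T' A B.
have ui : u * u^-1 = 1 by rewrite divff// gt_eqF.
have H1 : u * (u + t)^-1 <= 1 by rewrite ler_pdivrMr// mul1r lerDl ltW.
have H2 : u * (u + t) ^- 2 <= 1.
  rewrite ler_pdivrMr ?exprn_gt0// mul1r expr2.
  by rewrite -[leLHS]mulr1; apply: ler_pM; rewrite ?(ltW u10)//; lra.
have : u * - (u + t) ^- 2 <= u * (T - T' - (u^-1 - (u + t)^-1)).
  by rewrite ler_pM2l//; lra.
lra.
Qed.

End digamma.

(** * Positivity of the elementary increments *)

Section rational_bounds.
Context {R : realType}.
Implicit Types (f df : R -> R) (x y : R).

(** The mean value theorem on [[x, x + 1]]; it supplies the shift hypothesis of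
    [gt0_of_decreasing_shift]. *)
Lemma derive_lt0_shift f df :
  (forall x, 0 < x -> is_derive x 1 f (df x)) ->
  (forall x, 0 < x -> df x < 0) ->
  forall x, 0 < x -> f (x + 1) < f x.
Proof.
move=> dfE df0 x x0.
have xx1 : x < x + 1 by rewrite ltrDl.
have [||y] := @MVT R f df x (x + 1) xx1.
- by move=> y; rewrite in_itv/= => /andP[xy _]; apply: dfE; exact: lt_trans xy.
- apply: continuous_in_subspaceT => y; rewrite inE/= in_itv/= => /andP[xy _].
  apply: differentiable_continuous; apply/derivable1_diffP; apply: ex_derive.
  by apply: dfE; exact: lt_le_trans xy.
rewrite in_itv/= => /andP[xy _].
rewrite [x + 1 - x]addrAC subrr add0r mulr1 => E.
by rewrite -subr_lt0 E df0//; exact: lt_trans xy.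
Qed.

Lemma is_derive_inv f x d : f x != 0 -> is_derive x 1 f d ->
  is_derive x 1 (fun y => (f y)^-1) (- d / f x ^+ 2).
Proof.
move=> fx0 dfx; refine (is_derive_eq (is_deriveV fx0 dfx) _).
by rewrite /GRing.scale/= mulrC mulrN mulNr.
Qed.

Lemma is_derive_inv_sq f x d : f x != 0 -> is_derive x 1 f d ->
  is_derive x 1 (fun y => (f y)^-1 * (f y)^-1) (- 2 * d / f x ^+ 3).
Proof.
move=> fx0 dfx; have di := is_derive_inv fx0 dfx.
refine (is_derive_eq (is_deriveM di di) _).
by rewrite /GRing.scale/=; field.
Qed.

Lemma is_derive_addr x a : is_derive x 1 (fun y => y + a) 1.
Proof.
by rewrite -[X in is_derive _ _ _ X]addr0; exact: is_deriveD.
Qed.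

Lemma is_derive_lnD1 x : 0 < x ->
  is_derive x 1 (fun y => ln (y + 1) - ln y) ((x + 1)^-1 - x^-1).
Proof.
move=> x0; have x10 : 0 < x + 1 by rewrite addr_gt0.
have d1 := @is_derive1_comp R (@ln R) (fun y => y + 1) x _ _
  (is_derive1_ln x10) (is_derive_addr x 1).
refine (is_derive_eq (is_deriveB d1 (is_derive1_ln x0)) _).
by rewrite mulr1.
Qed.

(** The drop from [x] to [x + 1] of [ln x - digamma x - 1/2 trigamma (x + 1/3)]. *)
Let g x := x^-1 - (ln (x + 1) - ln x) -
  1 / 2 * ((x + 1 / 3)^-1 * (x + 1 / 3)^-1).

Lemma lower_increment_gt0 x : 0 < x -> 0 < g x.
Proof.
apply: (@gt0_of_decreasing_shift R g 1).
  apply: (@derive_lt0_shift g (fun x => - 1 / x ^+ 2 - ((x + 1)^-1 - x^-1) -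
      1 / 2 * (- 2 * 1 / (x + 1 / 3) ^+ 3))) => {}x x0.
    have x30 : x + 1 / 3 != 0 by rewrite gt_eqF//; lra.
    have d1 := is_derive_inv (f := id) (lt0r_neq0 x0) (is_derive_id _ _).
    have d2 := is_derive_lnD1 x0.
    have d3 := is_deriveZ (1 / 2)
      (is_derive_inv_sq (f := fun y => y + 1 / 3) x30
        (is_derive_addr x (1 / 3))).
    exact: (is_deriveB (is_deriveB d1 d2) d3).
  have x10 : 0 < x + 1 by lra.
  have x30 : 0 < 3 * x + 1 by lra.
  (* The shift [1/3] makes the cubic and quadratic terms of [27 x^2 (x + 1) - (3 x + 1)^3]
     cancel. *)
  rewrite [ltLHS](_ : _ = - ((9 * x + 1) /
    (x ^+ 2 * (x + 1) * (3 * x + 1) ^+ 3))); last first.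
    by field; rewrite !gt_eqF//; lra.
  rewrite oppr_lt0 divr_gt0 ?mulr_gt0 ?exprn_gt0//; lra.
move=> {}x x1; have x0 : 0 < x by lra.
have H := le_ln_sub x0 (addr_gt0 x0 ltr01).
have {}H : ln (x + 1) - ln x <= x^-1.
  by move: H; rewrite (_ : x + 1 - x = 1) ?div1r//; ring.
have : x * (- (1 / 2 * ((x + 1 / 3)^-1 * (x + 1 / 3)^-1))) <= x * g x.
  by rewrite ler_pM2l// /g; move: (ln _) (ln _) H => a b; lra.
apply: le_trans.
have y0 : 0 < x + 1 / 3 by lra.
have K : x * ((x + 1 / 3)^-1 * (x + 1 / 3)^-1) <= 1.
  by rewrite -invfM ler_pdivrMr ?mulr_gt0//; nra.
by move: (_ * _^-1) K => I K; lra.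
Qed.

(* The argument of [trigamma] in the upper bound. *)
Let h x := x + 1 / 3 - 1 / (12 * x + 3).

Lemma shiftE x : 0 < x -> h x = x * (12 * x + 7) / (3 * (4 * x + 1)).
Proof. by move=> x0; rewrite /h; field; rewrite !gt_eqF//; lra. Qed.

Lemma shift_gt0 x : 0 < x -> 0 < h x.
Proof. by move=> x0; rewrite shiftE// divr_gt0 ?mulr_gt0//; lra. Qed.

Lemma shiftD1_gt x : 0 < x -> h x + 1 < h (x + 1).
Proof.
move=> x0; rewrite -subr_gt0.
rewrite [ltRHS](_ : _ = 12 / ((12 * x + 3) * (12 * x + 15))).
  by rewrite divr_gt0 ?mulr_gt0//; lra.
by rewrite /h; field; rewrite !gt_eqF//; lra.
Qed.

Let dh x := 1 + 12 / (12 * x + 3) ^+ 2.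

Lemma is_derive_shift x : 0 < x -> is_derive x 1 h (dh x).
Proof.
move=> x0; have q0 : 12 * x + 3 != 0 by rewrite gt_eqF//; lra.
have d1 : is_derive x 1 (fun y => 12 * y + 3) 12.
  refine (is_derive_eq (is_deriveD (is_deriveZ (12 : R) (is_derive_id x 1))
    (is_derive_cst (3 : R) x 1)) _).
  by rewrite /GRing.scale/= mulr1 addr0.
have d2 := is_deriveZ 1 (is_derive_inv (f := fun y => 12 * y + 3) q0 d1).
refine (is_derive_eq (is_deriveB (is_derive_addr x (1 / 3)) d2) _).
by rewrite /GRing.scale/= /dh; field.
Qed.

(** A strict lower bound for the drop from [x] to [x + 1] of
    [1/2 trigamma (h x) - (ln x - digamma x)]: [trigamma (h x)] is shifted once, then
    [trigamma_sub_gt] compares [h x + 1] with [h (x + 1)]. *)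
Let E x := 1 / 2 * ((h x)^-1 * (h x)^-1 + (h x + 1)^-1 - (h (x + 1))^-1)
  + (ln (x + 1) - ln x) - x^-1.

Let dE x := 1 / 2 * (- 2 * dh x / h x ^+ 3 + - dh x / (h x + 1) ^+ 2
    - - dh (x + 1) / h (x + 1) ^+ 2)
  + ((x + 1)^-1 - x^-1) - - 1 / x ^+ 2.

(** Over a common denominator, [dE x] is minus a polynomial with positive coefficients. The
    denominator collects the numerators of [h x], [h x + 1] and [h (x + 1)]. *)
Lemma upper_increment_derive_lt0 x : 0 < x -> dE x < 0.
Proof.
move=> x0; have x10 : 0 < x + 1 by rewrite addr_gt0.
rewrite /dE !shiftE// /dh.
(* Numerals are unary, so the coefficients are written in base 1000. *)
set P :=
  (204 * 1000 + 687) +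
  ((3 * 1000 + 666) * 1000 + 753) * x +
  ((25 * 1000 + 174) * 1000 + 929) * x ^+ 2 +
  ((85 * 1000 + 894) * 1000 + 919) * x ^+ 3 +
  ((163 * 1000 + 21) * 1000 + 184) * x ^+ 4 +
  ((190 * 1000 + 316) * 1000 + 256) * x ^+ 5 +
  ((150 * 1000 + 754) * 1000 + 176) * x ^+ 6 +
  ((86 * 1000 + 337) * 1000 + 792) * x ^+ 7 +
  ((33 * 1000 + 11) * 1000 + 712) * x ^+ 8 +
  ((5 * 1000 + 971) * 1000 + 968) * x ^+ 9.
rewrite [ltLHS](_ : _ = - (P / (x ^+ 3 * (12 * x + 7) ^+ 3 *
  (12 * x ^+ 2 + 19 * x + 3) ^+ 2 * (x + 1) ^+ 2 * (12 * x + 19) ^+ 2))).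
  rewrite oppr_lt0 divr_gt0//; last first.
    by rewrite !mulr_gt0 ?exprn_gt0 ?addr_gt0 ?mulr_gt0 ?exprn_gt0.
  have px k : 0 < x ^+ k by exact: exprn_gt0.
  have := (px 2, px 3, px 4, px 5, px 6, px 7, px 8, px 9)%N.
  by move=> [[[[[[[p2 p3] p4] p5] p6] p7] p8] p9]; rewrite /P; lra.
rewrite /P; field.
have : 0 < 12 * x ^+ 2 by rewrite mulr_gt0 ?exprn_gt0.
by move=> ?; rewrite !gt_eqF//; lra.
Qed.

Lemma upper_increment_gt0 x : 0 < x -> 0 < E x.
Proof.
apply: (@gt0_of_decreasing_shift R E 1).
  apply: (@derive_lt0_shift E dE); last exact: upper_increment_derive_lt0.
  move=> {}x x0; have x10 : 0 < x + 1 by rewrite addr_gt0.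
  have h0 := shift_gt0 x0; have h10 := shift_gt0 x10.
  have dhx := is_derive_shift x0.
  have d1 := is_derive_inv_sq (f := h) (lt0r_neq0 h0) dhx.
  have dhx1 : is_derive x 1 (fun y => h y + 1) (dh x + 0) by apply: is_deriveD.
  have d2 := is_derive_inv (f := fun y => h y + 1) (lt0r_neq0 (addr_gt0 h0 ltr01)) dhx1.
  have dhS := @is_derive1_comp R h (fun y => y + 1) x _ _ (is_derive_shift x10)
    (is_derive_addr x 1).
  have d3 := is_derive_inv (f := h \o (fun y => y + 1)) (lt0r_neq0 h10) dhS.
  have d4 := is_deriveZ (1 / 2) (is_deriveB (is_deriveD d1 d2) d3).
  have d5 := is_derive_inv (f := id) (lt0r_neq0 x0) (is_derive_id _ _).
  refine (is_derive_eq (is_deriveB (is_deriveD d4 (is_derive_lnD1 x0)) d5) _).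
  by rewrite /GRing.scale/= /dE addr0 mulr1.
move=> {}x x1; have x0 : 0 < x by lra.
have h0 := shift_gt0 x0.
have hh := shiftD1_gt x0.
have A1 : 0 <= (h x)^-1 * (h x)^-1 by rewrite mulr_ge0 ?invr_ge0 ?ltW.
have A2 : (h (x + 1))^-1 <= (h x + 1)^-1.
  rewrite lef_pV2 ?(ltW hh)// posrE; last exact: addr_gt0.
  by apply: shift_gt0; rewrite addr_gt0.
have A3 : ln x <= ln (x + 1) by rewrite ler_ln ?posrE ?addr_gt0// lerDl.
(* Every other group of terms in [E x] is nonnegative, so only [- 1/x] remains. *)
have : x * - x^-1 <= x * E x.
  rewrite ler_pM2l// /E.
  move: (ln x) (ln (x + 1)) ((h x)^-1 * (h x)^-1) (h x + 1)^-1 (h (x + 1))^-1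
    x^-1 A1 A2 A3 => a b c d e k.
  lra.
by rewrite mulrN divff// gt_eqF.
Qed.

End rational_bounds.

(** * Telescoping of the two differences *)

Theorem theorem2p2 (R : realType) (x : R) (hx : 0 < x) :
  1 / 2 * trigamma (x + 1 / 3) < ln x - digamma x
  /\ ln x - digamma x
     < 1 / 2 * trigamma (x + 1 / 3 - 1 / (12 * x + 3)).
Proof.
split; rewrite -subr_gt0.
- move: x hx; apply: (@gt0_of_decreasing_shift R (fun x =>
    ln x - digamma x - 1 / 2 * trigamma (x + 1 / 3)) 1) => x x0.
    have y0 : 0 < x + 1 / 3 by lra.
    have G := lower_increment_gt0 x0.
    rewrite (_ : x + 1 + 1 / 3 = x + 1 / 3 + 1); last by ring.
    rewrite (digammaD1 x0) (trigammaD1 y0).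
    rewrite -invfM -expr2 in G.
    move: (ln x) (ln (x + 1)) (digamma x) (trigamma _) G => a b c d; lra.
  have {}x0 : 0 < x by lra.
  have y0 : 0 < x + 1 / 3 by lra.
  (* With [y = x + 1/3], the difference is at least [- 1/2 (1/y + 1/y^2)], hence at least
     [- 1/x]. *)
  have B := trigamma_le y0; have A := digamma_le_ln x0.
  have K1 : x * (x + 1 / 3)^-1 <= 1 by rewrite ler_pdivrMr//; lra.
  have K2 : x * (x + 1 / 3) ^- 2 <= 1.
    by rewrite ler_pdivrMr ?exprn_gt0// expr2; nra.
  have {}B := ler_wpM2l (ltW x0) B; have {}A := ler_wpM2l (ltW x0) A.
  move: (ln x) (digamma x) (trigamma _) (x + 1 / 3)^-1 ((x + 1 / 3) ^- 2) A B K1 K2.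
  by move=> a b c d e; lra.
- move: x hx; apply: (@gt0_of_decreasing_shift R (fun x =>
    1 / 2 * trigamma (x + 1 / 3 - 1 / (12 * x + 3)) - (ln x - digamma x)) 1) => x x0.
    have h0 := shift_gt0 x0.
    have D := trigamma_sub_gt (addr_gt0 h0 ltr01) (shiftD1_gt x0).
    have G := upper_increment_gt0 x0.
    rewrite (trigammaD1 h0) in D; rewrite (digammaD1 x0).
    rewrite -invfM -expr2 in G.
    move: (ln x) (ln (x + 1)) (digamma x) (trigamma (x + _ - _)) (trigamma (x + 1 + _ - _)) G D.
    by move=> a b c d e; lra.
  have {}x0 : 0 < x by lra.
  have h0 := shift_gt0 x0.
  (* Here [trigamma] is nonnegative and [ln x - digamma x <= 1/x]. *)
  have A := digamma_ge_ln x0; have B := trigamma_ge h0.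
  have {}B : 0 <= trigamma (x + 1 / 3 - 1 / (12 * x + 3)).
    by apply: le_trans B; rewrite invr_ge0 ltW.
  have K : x * x^-1 = 1 by rewrite divff// gt_eqF.
  have {}A := ler_wpM2l (ltW x0) A; have {}B := mulr_ge0 (ltW x0) B.
  move: (ln x) (digamma x) (trigamma _) x^-1 A B K.
  by move=> a b c d; lra.
Qed.
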